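(* There is a function $\varepsilon:\mathbb{N}\to\mathbb{R}$ with $\varepsilon(n)\to 0$ as $n\to\infty$ such that for every sufficiently large $n$ and every simple connected graph $G$ on $n$ vertices, $$ {\rm SJ}(G)\ge 4+\varepsilon(n), $$ i.e. ${\rm SJ}(G)\ge 4+o(1)$.
   Context: For a simple connected graph $G$ with $n$ vertices and $m$ edges, ${\rm dist}_G(u,v)$ denotes the distance between vertices $u,v$, and the transmission of a vertex $u$ is $w(u)=\sum_{x\in V(G)}{\rm dist}_G(u,x)$. The sum-Balaban index of $G$ is $$ {\rm SJ}(G)=\frac{m}{m-n+2}\sum_{uv\in E(G)}\frac{1}{\sqrt{w(u)+w(v)}}. $$ *)

(* Defs.v *)
(* A simple graph on a finType T is encoded as a symmetric irreflexive
   relation e : rel T (adjacency). *)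
From mathcomp Require Import all_boot all_order all_algebra.
From mathcomp Require Import reals.

Set Implicit Arguments.
Unset Strict Implicit.
Unset Printing Implicit Defensive.

Import Order.TTheory GRing.Theory Num.Theory.
Local Open Scope ring_scope.

Definition simple_graph (T : finType) (e : rel T) : Prop :=
  symmetric e /\ irreflexive e.

Definition connected_graph (T : finType) (e : rel T) : Prop :=
  forall x y : T, connect e x y.

(* The least length (number of edges) of an e-walk from x to y.  Lengths below
   #|T| suffice, since a shortest walk repeats no vertex; #|T| is the junk value
   when y is not reachable from x. *)
Definition gdist (T : finType) (e : rel T) (x y : T) : nat :=
  \big[Order.min/#|T|]_(k < #|T| |
      [exists p : k.-tuple T, path e x p && (last x p == y)]) (k : nat).

Definition transmission (T : finType) (e : rel T) (u : T) : nat :=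
  (\sum_(x : T) gdist e u x)%N.

(* Unordered edges, as two-element vertex sets. *)
Definition edges (T : finType) (e : rel T) : {set {set T}} :=
  [set [set p.1; p.2] | p : T * T & e p.1 p.2].

(* For an edge E = {u, v} we have u != v, so the sum of the transmissions of the
   elements of E is w(u) + w(v).  The difference m - n is taken in R, not in nat
   (m = n - 1 for trees). *)
Definition sum_balaban (R : realType) (T : finType) (e : rel T) : R :=
  let n := #|T| in
  let m := #|edges e| in
  m%:R / (m%:R - n%:R + 2) *
  \sum_(E in edges e) 1 / Num.sqrt (\sum_(u in E) transmission e u)%N%:R.

(* Main.v *)
(* Every transmission is at most n(n-1)/2, with equality at the end of a path,
   so each edge contributes at least 1/n and SJ(G) >= m^2 / (n (m - n + 2)).
   With a = m - n + 2, which is positive because m >= n - 1, the numerator is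
   (a + (n - 2))^2 >= 4 a (n - 2); hence SJ(G) >= 4 - 8 / n. *)
Require Import Defs.
From mathcomp Require Import all_boot all_order all_algebra.
From mathcomp Require Import boolp classical_sets reals topology normedtype sequences.
From mathcomp Require Import zify ring lra.

Set Implicit Arguments.
Unset Strict Implicit.
Unset Printing Implicit Defensive.

Import Order.TTheory GRing.Theory Num.Theory.
Import numFieldNormedType.Exports.
Local Open Scope classical_set_scope.
Local Open Scope ring_scope.

(** [d] abstracts the distance from a fixed root. Descending from [x] one value at a time passes
    through [k]. *)
Lemma gapfree_surj (T : finType) (d : T -> nat) (x : T) (k : nat) :
  (forall x j, d x = j.+1 -> exists y, d y = j) ->
  (k <= d x)%N -> exists y, d y = k.
Proof.
move=> dS; move Ej: (d x) => j; elim: j x Ej => [|j IHj] x dx.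
  by rewrite leqn0 => /eqP->; exists x.
rewrite leq_eqVlt => /predU1P[->|]; first by exists x.
by rewrite ltnS; have [y dy] := dS _ _ dx; apply: IHj dy.
Qed.

(** Once some value reaches [k], the values 0, ..., k-1 all occur, so at least [k] elements lie
    below the threshold. *)
Lemma gapfree_card_ge (T : finType) (d : T -> nat) (k : nat) :
  (forall x j, d x = j.+1 -> exists y, d y = j) ->
  (#|[pred x | k <= d x]| <= #|T| - k)%N.
Proof.
move=> dS; case: (pickP [pred x | k <= d x]%N) => [x /= kx|/eq_card0->//].
have kleq : (k <= #|[pred y | d y < k]|)%N.
  rewrite -{1}(size_iota 0 k) -(size_image d).
  apply: uniq_leq_size (iota_uniq _ _) _ => i; rewrite mem_iota add0n => ik.
  have [|y dy] := @gapfree_surj T d x i dS.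
    exact: leq_trans (ltnW ik) kx.
  by apply/fintype.imageP; exists y; rewrite // inE dy.
rewrite -(cardC [pred y | d y < k]%N).
rewrite (eq_card (_ : [predC _] =i [pred y | k <= d y]%N)); last first.
  by move=> y; rewrite !inE -leqNgt.
by rewrite -addnBAC // leq_addl.
Qed.

(** Layer by layer: [d x] counts the k < [d x], and the layer of those [x] with k < [d x] has at
    most n-1-k elements. *)
Lemma gapfree_sum_le (T : finType) (d : T -> nat) :
  (forall x j, d x = j.+1 -> exists y, d y = j) ->
  ((\sum_x d x).*2 <= #|T| * #|T|.-1)%N.
Proof.
move=> dS.
have dlt x : (d x <= #|T|)%N.
  have := gapfree_card_ge (d x) dS; rewrite leqNgt; apply: contraNleq => /ltnW.
  by rewrite -subn_eq0 => /eqP->; apply/card_gt0P; exists x; rewrite inE.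
have -> : (\sum_x d x = \sum_(k < #|T|) #|[pred x | k < d x]|)%N.
  rewrite [RHS](eq_bigr (fun k : 'I_#|T| => \sum_x (k < d x)))%N; last first.
    by move=> k _; rewrite -sum1_card big_mkcond.
  rewrite exchange_big; apply: eq_bigr => x _ /=.
  have := @big_ord_widen _ 0%N addn _ _ (fun=> 1%N) (dlt x).
  by rewrite /= big_const_ord iter_addn_0 mul1n big_mkcond.
apply: (@leq_trans (\sum_(k < #|T|) k).*2); last first.
  by rewrite -(big_mkord xpredT id) bin2_sum bin2 halfK leq_subr.
(* Reversal turns the index k into n-(k+1), the layer bound at threshold k+1. *)
rewrite leq_double [leqRHS](reindex_inj rev_ord_inj) /=.
by apply: leq_sum => k _; apply: gapfree_card_ge.
Qed.

Section Distance.
Variables (T : finType) (e : rel T).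

Lemma gdist_le (x : T) (p : seq T) :
  path e x p -> (gdist e x (last x p) <= size p)%N.
Proof.
move=> xp; rewrite /gdist; case: (ltnP (size p) #|T|) => [lt_p|le_p].
  have := @bigmin_le_cond _ _ _ #|T| (Ordinal lt_p)
    [pred k : 'I_#|T| | [exists q : k.-tuple T,
       path e x q && (last x q == last x p)]] (fun k => k : nat).
  rewrite leEnat; apply.
  by apply/existsP; exists (in_tuple p); rewrite /= xp eqxx.
(* For so long a walk the default value [#|T|] of the minimum is bound enough. *)
apply: leq_trans le_p; rewrite -leEnat; exact: bigmin_le_id.
Qed.

Lemma gdist_path (x y : T) : connect e x y ->
  exists p, [/\ path e x p, last x p = y & size p = gdist e x y].
Proof.
(* A repetition-free walk has length below [#|T|], so the minimum ranges over a nonempty set and is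
   attained. *)
case/connectP=> p /shortenP[q xq uq _] ->{p y}.
have lt_q : (size q < #|T|)%N.
  by rewrite -(card_uniqP uq : _ = (size q).+1) max_card.
rewrite /gdist (bigmin_eq_arg _ (Ordinal lt_q)) /=; first last.
- by move=> i _; rewrite leEnat ltnW.
- by apply/existsP; exists (in_tuple q); rewrite /= xq eqxx.
case: arg_minP => [|k /existsP[r /andP[xr /eqP rE]] _] /=.
  by apply/existsP; exists (in_tuple q); rewrite /= xq eqxx.
by exists r; rewrite size_tuple.
Qed.

Lemma gdist_eq0 (x y : T) : connect e x y -> gdist e x y = 0%N -> x = y.
Proof. by case/gdist_path=> -[|z p] [_ <- <-]. Qed.

(** Take the penultimate vertex of a shortest path: a shorter route to it would, extended by the
    last edge, shorten the way to [y]. This makes distances gap-free. *)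
Lemma gdist_pred (x y : T) (k : nat) : connect e x y ->
  gdist e x y = k.+1 -> exists2 z, e z y & gdist e x z = k.
Proof.
move=> cxy dxy; have [p [xp py]] := gdist_path cxy; rewrite dxy.
case/lastP: p xp py => [//|p z]; rewrite rcons_path last_rcons size_rcons.
move=> /andP[xp ez] zy [pk]; rewrite zy in ez.
exists (last x p) => //; apply/eqP; rewrite eqn_leq -{1}pk gdist_le //=.
have [|q [xq qz qs]] := @gdist_path x (last x p).
  by apply/connectP; exists p.
rewrite -ltnS -dxy -qs -(size_rcons q y) -{1}(last_rcons x q y) gdist_le //.
by rewrite rcons_path xq qz.
Qed.

Hypothesis ce : connected_graph e.

Lemma transmission_le (u : T) : ((transmission e u).*2 <= #|T| * #|T|.-1)%N.
Proof.
apply: gapfree_sum_le => x j /gdist_pred[//|y _ dy]; by exists y.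
Qed.

Lemma transmission_gt0 (u v : T) : u != v -> (0 < transmission e u)%N.
Proof.
move=> uv; rewrite /transmission (bigD1 v) //= addn_gt0 lt0n.
by apply/orP; left; apply: contra_neq uv => /(gdist_eq0 (ce u v)).
Qed.

(* Sending each vertex to the edge towards a neighbour closer to the root [r]
   is injective, since only one end of an edge can be the farther one. *)
Lemma connected_card_edges : (#|T| <= #|edges e|.+1)%N.
Proof.
case: (pickP (@predT T)) => [r _|/eq_card0->//].
have par v : exists z, v != r -> e z v && (gdist e r z < gdist e r v)%N.
  case E: (gdist e r v) => [|k].
    by exists v; rewrite (gdist_eq0 (ce r v) E) eqxx.
  by have [z ezv dz] := gdist_pred (ce r v) E; exists z; rewrite ezv dz ltnSn.
have [f fP] := boolp.choice par.
pose g v := [set f v; v]%SET.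
have ginj : {in [set~ r]%SET &, injective g}.
  move=> u v; rewrite !inE => /fP/andP[_ fu] /fP/andP[_ fv] guv.
  have : u \in g v by rewrite -guv !inE eqxx orbT.
  (* If [u] and [v] differ, each is the parent of the other, hence strictly closer to [r] than the
     other. *)
  have : v \in g u by rewrite guv !inE eqxx orbT.
  rewrite !inE => /predU1P[vE|/eqP//] /predU1P[uE|/eqP//].
  by move: fu fv; rewrite -vE -uE; lia.
rewrite -(prednK (_ : 0 < #|T|)%N); last by apply/card_gt0P; exists r.
rewrite ltnS -(cardsC1 r) -(card_in_imset ginj).
apply/subset_leq_card/fintype.subsetP => E /imsetP[v vr ->{E}].
have /andP[efv _] : e (f v) v && (gdist e r (f v) < gdist e r v)%N.
  by apply: fP; rewrite !inE in vr.
by apply/imsetP; exists (f v, v); rewrite ?inE.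
Qed.

End Distance.

Lemma edge_term_ge (R : realType) (T : finType) (e : rel T) (E : {set T}) :
  simple_graph e -> connected_graph e -> E \in edges e ->
  #|T|%:R^-1 <= 1 / Num.sqrt (\sum_(u in E) transmission e u)%N%:R :> R.
Proof.
move=> [_ ie] ce /imsetP[[u v]]; rewrite inE /= => euv ->.
have uv : u != v by apply: contraTneq euv => ->; rewrite ie.
rewrite big_setU1 ?inE //= big_set1 div1r.
have wu := transmission_le ce u; have wv := transmission_le ce v.
(* Needed because the inverse of 0 is 0: inverses reverse the order only between positive
   numbers. *)
have s0 : (0 < transmission e u + transmission e v)%N.
  by rewrite addn_gt0 (transmission_gt0 ce uv).
have n0 : (0 < #|T|)%N by apply/card_gt0P; exists u.
rewrite lef_pV2 ?posrE ?sqrtr_gt0 ?ltr0n //.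
rewrite -(ger0_norm (ler0n R #|T|)) -sqrtr_sqr ler_wsqrtr // -natrX ler_nat.
(* The two transmissions add up to at most n(n-1), which is below n^2. *)
by move: wu wv; case: #|T| n0 => // n _; rewrite /= expnS expn1; nia.
Qed.

Lemma sum_balaban_ge (R : realType) (T : finType) (e : rel T) :
  simple_graph e -> connected_graph e -> (0 < #|T|)%N ->
  4 - 8 / #|T|%:R <= sum_balaban R e.
Proof.
move=> se ce n0; rewrite /sum_balaban /=.
set S := \sum_(E in _) _; set n : R := #|T|%:R; set m : R := #|edges e|%:R.
have n_gt0 : 0 < n by rewrite ltr0n.
have a_gt0 : 0 < m - n + 2.
  have : n <= m + 1 by rewrite natr1 ler_nat connected_card_edges.
  by lra.
have Sge : m / n <= S.
  rewrite mulr_natl -sumr_const; apply: ler_sum => E eE.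
  exact: edge_term_ge.
apply: le_trans (ler_wpM2l _ Sge); last by rewrite divr_ge0 ?ler0n// ltW.
have -> : m / (m - n + 2) * (m / n) = m ^+ 2 / ((m - n + 2) * n).
  by field; rewrite !gt_eqF.
rewrite ler_pdivlMr ?mulr_gt0 //.
have -> : (4 - 8 / n) * ((m - n + 2) * n) = 4 * (n - 2) * (m - n + 2).
  by field; rewrite gt_eqF.
rewrite -subr_ge0.
(* The base of the square is the difference of [m - n + 2] and [n - 2], whose sum is [m]. *)
have -> : m ^+ 2 - 4 * (n - 2) * (m - n + 2) = (m - 2 * n + 4) ^+ 2 by ring.
exact: sqr_ge0.
Qed.

Theorem theorem2 (R : realType) :
  exists eps : nat -> R,
    eps n @[n --> \oo] --> (0 : R) /\
    exists N : nat, forall n : nat, (N <= n)%N ->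
      forall (T : finType) (e : rel T),
        simple_graph e -> connected_graph e -> #|T| = n ->
        4 + eps n <= sum_balaban R e.
Proof.
exists (fun n => - (8 / n%:R)); split; last first.
  exists 1%N => n n1 T e se ce nT.
  by rewrite -nT; apply: sum_balaban_ge; rewrite ?nT.
rewrite -oppr0; apply: cvgN; rewrite -(mulr0 (8 : R)).
apply: cvgM; first exact: cvg_cst.
(* The harmonic sequence is 1/(n+1), hence the shift by one. *)
by rewrite -(cvg_shiftS (fun n => n%:R^-1 : R)); exact: cvg_harmonic.
Qed.
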